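(* Let $X$ be a finite indecomposable cycle set whose permutation group $\mathcal{G}(X)$ is innately transitive on $X$. Then $X$ is a trivial indecomposable cycle set of size $p$, for some prime number $p$.
   Context: A left quasigroup $(X,\cdot)$ is a non-empty set with a binary operation such that $\sigma_x:y\mapsto x\cdot y$ is bijective for every $x$. A cycle set is a left quasigroup with $(x\cdot y)\cdot(x\cdot z)=(y\cdot x)\cdot(y\cdot z)$ for all $x,y,z$; all cycle sets are assumed non-degenerate, i.e. $x\mapsto x\cdot x$ is bijective. $\mathcal{G}(X)=\langle\sigma_x\mid x\in X\rangle\le \mathrm{Sym}(X)$, and $X$ is indecomposable if $\mathcal{G}(X)$ is transitive on $X$. A permutation group of a finite set $X$ is innately transitive if it has a minimal normal subgroup acting transitively on $X$. A trivial cycle set is one of the form $x\cdot y=\gamma(y)$ for a fixed $\gamma\in\mathrm{Sym}(X)$. *)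

(* Defs.v *)
From mathcomp Require Import all_boot all_fingroup all_solvable.

Set Implicit Arguments.
Unset Strict Implicit.
Unset Printing Implicit Defensive.

Import GroupScope.

Definition left_quasigroup (X : Type) (op : X -> X -> X) : Prop :=
  inhabited X /\ forall x, bijective (op x).

Definition cycle_law (X : Type) (op : X -> X -> X) : Prop :=
  forall x y z, op (op x y) (op x z) = op (op y x) (op y z).

Definition non_degenerate (X : Type) (op : X -> X -> X) : Prop :=
  bijective (fun x => op x x).

(* Cycle sets are non-degenerate by convention. *)
Record finCycleSet := FinCycleSet {
  cs_sort :> finType;
  cs_op : cs_sort -> cs_sort -> cs_sort;
  cs_left_quasigroup : left_quasigroup cs_op;
  cs_cycle_law : cycle_law cs_op;
  cs_non_degenerate : non_degenerate cs_op
}.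

Definition sigma (X : finCycleSet) (x : X) : {perm X} :=
  perm (bij_inj (proj2 (cs_left_quasigroup X) x)).

Lemma sigmaE (X : finCycleSet) (x y : X) : sigma x y = cs_op x y.
Proof. by rewrite permE. Qed.

(* The product of {perm X} composes from left to right; the subgroup generated
   by the sigma x does not depend on this choice. *)
Definition permutation_group (X : finCycleSet) : {group {perm X}} :=
  <<[set sigma x | x : X]>>%G.

Definition indecomposable (X : finCycleSet) : Prop :=
  [transitive permutation_group X, on [set: X] | 'P].

(* minnormal M G says that M is minimal among the nontrivial groups normalised
   by G; it does not by itself imply M \subset G. *)
Definition innately_transitive (T : finType) (G : {group {perm T}}) : Prop :=
  exists M : {group {perm T}},
    [/\ M <| G, minnormal M G & [transitive M, on [set: T] | 'P]].

Definition trivial_cycle_set (X : finCycleSet) : Prop :=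
  exists gamma : {perm X}, forall x y : X, cs_op x y = gamma y.

(* Main.v *)
(** Let [G] be the permutation group.  In the symmetric group of [G], the maps
    [g |-> g * sigma (g x)] generate an abelian regular group [A] normalised by
    the regular group [L] of left multiplications, and [L] permutes these
    generators as [G] permutes the points [x].  (This is the brace structure of
    [G] seen in its holomorph.)  If [S] is a point stabiliser in [A L], then
    [A S = L S = A L], so that [L :&: 'O_pi(A) S] is a Hall [pi]-subgroup of [L]
    for every [pi], whence [G] is solvable by Hall's theorem.  A transitive
    minimal normal subgroup [M] is therefore an elementary abelian [p]-group;
    let [N] be its copy in [L].  A commutator of [N] with ['O_p^'(A)] lies in
    ['O_p^'(A) :&: 'O_p(A) S = 1], so the [p']-parts of the generators of [A] are
    fixed by [N], hence all equal, and [L] centralises ['O_p^'(A)].  Then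
    [L :&: 'O_p(A) S] is a normal [p]-subgroup, which must be [N] because [N] is
    self-centralising.  Finally [L :&: 'C_('O_p(A))(N) S] is a nontrivial normal
    subgroup inside [N], so it is [N]; thus [N] centralises [A], which says that
    [sigma] is constant. *)

Require Import Defs.
From mathcomp Require Import all_boot all_fingroup all_solvable.
From mathcomp Require Import integral_char.

Set Implicit Arguments.
Unset Strict Implicit.
Unset Printing Implicit Defensive.

Import GroupScope.

(** * Solvability criteria of Wielandt and Hall *)

(* [K] contains some conjugate [M :^ (h * k)]; as [h] normalises [M] and [k] lies
   in [K], it contains [M], and likewise every other conjugate. *)
Lemma conjugates_sub_p'index_factor (gT : finGroupType) (G H K M : {group gT}) (p : nat) :
    H \subset G -> K \subset G -> H * K = G ->
    prime p -> ~~ (p %| #|G : K|) -> p.-group M -> M \subset H ->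
    H \subset 'N(M) -> forall g, g \in G -> M :^ g \subset K.
Proof.
move=> sHG sKG defG p_pr p'iK pM sMH nMH.
have [P sylP] := Sylow_exists p K.
have sylPG : p.-Sylow(G) P.
  rewrite pHallE (subset_trans (pHall_sub sylP) sKG) (card_Hall sylP).
  rewrite -(Lagrange sKG) partnM ?cardG_gt0 ?indexg_gt0 // -[X in X == _]muln1.
  by rewrite eqn_pmul2l ?part_gt0 // eq_sym (part_p'nat (pi := p)) // p'natE.
have conjM h k : h \in H -> k \in K -> (M :^ (h * k) \subset K) = (M \subset K).
  move=> Hh Kk; rewrite conjsgM (normsP nMH) // -{1}(conjGid Kk).
  by rewrite conjSg.
have [x] := Sylow_Jsub sylPG (subset_trans sMH sHG) pM.
rewrite -defG => /mulsgP[h k Hh Kk ->] sMP _ /mulsgP[h' k' Hh' Kk' ->].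
by rewrite conjM // -(conjM h k) // (subset_trans sMP) // (pHall_sub sylP).
Qed.

(** Induction on the order: a minimal normal subgroup [M] of [H1] is a [p]-group, and [p] cannot
    divide the indices of both [H2] and [H3], so one of these contains all conjugates of [M]. Hence
    the normal closure of [M] is solvable, and the quotient inherits the hypotheses. *)
Theorem Wielandt_solvable (gT : finGroupType) (G H1 H2 H3 : {group gT}) :
    [/\ H1 \subset G, H2 \subset G & H3 \subset G] ->
    [/\ solvable H1, solvable H2 & solvable H3] ->
    [/\ coprime #|G : H1| #|G : H2|, coprime #|G : H1| #|G : H3|
      & coprime #|G : H2| #|G : H3|] ->
  solvable G.
Proof.
move: {2}_.+1 (ltnSn #|G|) => n.
elim: n => // n IHn in gT G H1 H2 H3 *; rewrite ltnS => leGn.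
case=> s1 s2 s3 [sol1 sol2 sol3] [co12 co13 co23].
have [H1_1 | ntH1] := eqVneq (gval H1) 1.
  suff sG2 : G \subset H2 by apply: solvableS sol2.
  rewrite -indexg_eq1; have := co12.
  rewrite H1_1 indexg1 -(Lagrange s2) coprimeMl => /andP[_].
  by rewrite /coprime gcdnn.
have [M minM sMH1] := minnormal_exists ntH1 (normG H1).
have [nMH1 ntM /is_abelemP[p p_pr abM]] := minnormal_solvable minM sMH1 sol1.
have pM := abelem_pgroup abM.
have [K [sKG solK sMK]] : exists K : {group gT},
    [/\ K \subset G, solvable K & forall g, g \in G -> M :^ g \subset K].
  have defG2 := coprime_index_mulG s1 s2 co12.
  have defG3 := coprime_index_mulG s1 s3 co13.
  have [p2 | p'2] := boolP (p %| #|G : H2|); last first.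
    by exists H2; split=> //; apply: conjugates_sub_p'index_factor p'2 pM sMH1 nMH1.
  exists H3; split=> //; apply: conjugates_sub_p'index_factor pM sMH1 nMH1 => //.
  apply: contraL co23 => p3; rewrite /coprime -dvdn1.
  apply: contraL (prime_gt1 p_pr) => d1; rewrite -leqNgt dvdn_leq //.
  by rewrite (dvdn_trans _ d1) // dvdn_gcd p2.
pose Q := <<class_support M G>>%G.
have nsQG : Q <| G.
  rewrite /normal gen_subG class_support_subG ?(subset_trans sMH1) //=.
  by rewrite norms_gen // class_support_norm.
have solQ : solvable Q.
  apply: solvableS solK; rewrite gen_subG class_supportEr.
  by apply/bigcupsP=> g /sMK.
have sMQ : M \subset Q by rewrite sub_gen // sub_class_support.
rewrite (series_sol nsQG) solQ /=.
have nQ (H : {group gT}) : H \subset G -> H \subset 'N(Q).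
  by move=> sHG; apply: subset_trans sHG (normal_norm nsQG).
have co (H K' : {group gT}) : H \subset G -> K' \subset G -> coprime #|G : H| #|G : K'| ->
    coprime #|G / Q : H / Q| #|G / Q : K' / Q|.
  move=> sHG sKG' coHK; apply: coprime_dvdl (coprime_dvdr _ coHK);
    by rewrite index_quotient // subIset // nQ.
apply: (IHn _ _ (H1 / Q) (H2 / Q) (H3 / Q))%G.
- rewrite (leq_trans _ leGn) // ltn_quotient ?normal_sub //.
  by apply: contraNneq ntM => Q1; rewrite -subG1 -Q1.
- by rewrite !quotientS.
- by rewrite !quotient_sol.
- by rewrite !co.
Qed.

(** At most two prime divisors is Burnside's theorem. With three, the corresponding Hall complements
    have pairwise coprime indices and are solvable by induction. *)
Theorem Hall_complements_solvable (gT : finGroupType) (G : {group gT}) :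
    (forall p, prime p -> exists H : {group gT}, p^'.-Hall(G) H) ->
  solvable G.
Proof.
move: {2}_.+1 (ltnSn #|G|) => n.
elim: n => // n IHn in gT G *; rewrite ltnS => leGn hallG.
have [/integral_char.Burnside_p_a_q_b // | ] := leqP (size (primes #|G|)) 2.
have := primes_uniq #|G|; have := mem_primes^~ #|G|.
case: (primes _) => [|p [|q [|r ps]]] // mem_ps uniq_ps _.
have index_p'Hall (s : nat) (H : {group gT}) : s^'.-Hall(G) H -> s.-nat #|G : H|.
  by case/and3P=> _ _; rewrite pnatNK.
have co (s t : nat) (H K : {group gT}) : s != t -> s^'.-Hall(G) H -> t^'.-Hall(G) K ->
    coprime #|G : H| #|G : K|.
  move=> neq_st hallH hallK; apply: (@pnat_coprime s); first exact: index_p'Hall.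
  apply: sub_in_pnat (index_p'Hall _ _ hallK) => u _ /[!inE] /eqP->.
  by rewrite eq_sym.
have sol (s : nat) (H : {group gT}) : prime s -> s %| #|G| -> s^'.-Hall(G) H -> solvable H.
  move=> s_pr s_dv hallH; have sHG := pHall_sub hallH.
  apply: IHn => [|t t_pr].
    rewrite (leq_trans _ leGn) // proper_card // properEneq sHG andbT.
    apply: contraTneq s_dv => defH.
    by rewrite -p'natE // -defH; apply: pHall_pgroup hallH.
  have [K hallK] := hallG t t_pr; have [eq_st | neq_st] := eqVneq s t.
    by exists H; rewrite -eq_st (pHall_subl _ sHG hallH).
  (* Coprime indices give [K * H = G], so [H :&: K] has in [H] the index that [K] has in [G], a
     [t]-number. *)
  exists (H :&: K)%G; rewrite /pHall subsetIl (pgroupS (subsetIr _ _)) /=; last first.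
    exact: pHall_pgroup hallK.
  rewrite eq_sym in neq_st.
  have defG := coprime_index_mulG (pHall_sub hallK) sHG (co _ _ _ _ neq_st hallK hallH).
  by rewrite pnatNK indexgI -indexMg defG index_p'Hall.
have in_primes s : s \in [:: p, q, r & ps] -> prime s /\ s %| #|G|.
  by rewrite mem_ps => /and3P[].
have [[p_pr p_dv] [q_pr q_dv] [r_pr r_dv]] :
    [/\ prime p /\ p %| #|G|, prime q /\ q %| #|G| & prime r /\ r %| #|G|].
  by split; apply: in_primes; rewrite !inE eqxx ?orbT.
move: uniq_ps; rewrite /= !inE !negb_or => /and4P[/and3P[pq pr _] /andP[qr _] _ _].
have [[Hp hp] [Hq hq]] := (hallG p p_pr, hallG q q_pr).
have [Hr hr] := hallG r r_pr.
apply: (@Wielandt_solvable _ G Hp Hq Hr).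
- by rewrite !(pHall_sub hp, pHall_sub hq, pHall_sub hr).
- by rewrite (sol _ _ p_pr p_dv hp) (sol _ _ q_pr q_dv hq) (sol _ _ r_pr r_dv hr).
- by rewrite (co _ _ _ _ pq hp hq) (co _ _ _ _ pr hp hr) (co _ _ _ _ qr hq hr).
Qed.

(** * Factorizations of holomorph type *)

(* Here [L] need not be normal: [A] plays the translations of a holomorph, [L]
   another regular subgroup, [S] the stabiliser of a point in [A <*> L]. *)
Definition holomorph_factorization (gT : finGroupType) (A L S : {group gT}) : Prop :=
  [/\ abelian A, S \subset 'N(A), A * S = A <*> L, L * S = A <*> L
    & A :&: S = 1 /\ L :&: S = 1].

(** The modular law gives [(L :&: (B <*> S)) * S = B * S], and [S] meets both left factors
    trivially. *)
Lemma card_factor_part (gT : finGroupType) (A L S B : {group gT}) :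
    holomorph_factorization A L S -> B \subset A -> S \subset 'N(B) ->
  #|L :&: (B <*> S)| = #|B|.
Proof.
case=> _ _ defAS defLS [tiAS tiLS] sBA nBS.
have tiBS : B :&: S = 1 by apply/trivgP; rewrite -tiAS setSI.
have defBS : (L :&: (B <*> S)) * S = B * S.
  rewrite setIC group_modr ?joing_subr // defLS -defAS /= norm_joinEr //.
  by apply/setIidPl; rewrite mulSg.
apply/eqP; rewrite -(eqn_pmul2r (cardG_gt0 S)) -!TI_cardMg ?defBS //=.
by apply/trivgP; rewrite -tiLS setSI // subsetIl.
Qed.

Lemma factor_norm_pcore (gT : finGroupType) (A L S : {group gT}) (pi : nat_pred) :
    holomorph_factorization A L S -> A <*> L \subset 'N('O_pi(A)).
Proof.
case=> _ nAS defAS _ _; rewrite -defAS mulG_subG gFnorm /=.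
exact: gFnorm_trans.
Qed.

Lemma factor_normS (gT : finGroupType) (A L S : {group gT}) (pi : nat_pred) :
    holomorph_factorization A L S -> S \subset 'N('O_pi(A)).
Proof. by case=> _ nAS _ _ _; apply: gFnorm_trans. Qed.

Lemma factor_Hall (gT : finGroupType) (A L S : {group gT}) (pi : nat_pred) :
    holomorph_factorization A L S -> pi.-Hall(L) (L :&: ('O_pi(A) <*> S)).
Proof.
move=> hALS; have nS := factor_normS pi hALS.
have [abA nAS defAS defLS [tiAS tiLS]] := hALS.
have oAL : #|A| = #|L|.
  by apply/eqP; rewrite -(eqn_pmul2r (cardG_gt0 S)) -!TI_cardMg // defAS defLS.
rewrite pHallE subsetIl (card_factor_part hALS) ?pcore_sub //= -oAL.
by rewrite (card_Hall (nilpotent_pcore_Hall pi (abelian_nil abA))).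
Qed.

Lemma factor_solvable (gT : finGroupType) (A L S : {group gT}) :
  holomorph_factorization A L S -> solvable L.
Proof.
move=> hALS; apply: Hall_complements_solvable => p _.
by exists (L :&: ('O_p^'(A) <*> S))%G; apply: factor_Hall.
Qed.

Lemma abelian_pcoreE (gT : finGroupType) (A : {group gT}) (pi : nat_pred) :
  abelian A -> 'O_pi(A) * 'O_pi^'(A) = A.
Proof. by move/abelian_nil/(nilpotent_pcoreC pi)/dprodW. Qed.

Lemma normal_pgroup_sub_part (gT : finGroupType) (A L S N : {group gT}) (p : nat) :
    holomorph_factorization A L S -> N <| L -> p.-group N ->
  N \subset 'O_p(A) <*> S.
Proof.
move=> hALS nsNL pN; have hallLp := factor_Hall p hALS.
have := subset_trans (pcore_max pN nsNL) (pcore_sub_Hall hallLp).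
by rewrite subsetI => /andP[].
Qed.

Lemma normal_pgroup_cent_p'core (gT : finGroupType) (A L S N : {group gT}) (p : nat) :
    holomorph_factorization A L S -> N <| L -> p.-group N ->
  'O_p^'(A) \subset 'C(N).
Proof.
move=> hALS nsNL pN; have sNP := normal_pgroup_sub_part hALS nsNL pN.
have [abA nAS defAS defLS [tiAS tiLS]] := hALS.
have sNL := normal_sub nsNL; have nNL := normal_norm nsNL.
have nAp := factor_normS p hALS.
have nAp' := factor_norm_pcore p^' hALS.
have tiP : 'O_p^'(A) :&: ('O_p(A) <*> S) = 1.
  have sA_ pi : 'O_pi(A) \subset A by apply: pcore_sub.
  apply/trivgP/subsetP=> x /setIP[Ap'x] /=; rewrite norm_joinEr //.
  case/mulsgP=> y s Apy Ss def_x; have s1 : s = 1.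
    apply/set1P; suff: s \in A :&: S by rewrite tiAS.
    rewrite inE Ss andbT.
    rewrite -(mulKg y s) -def_x groupM ?groupV ?(subsetP (sA_ _) _ Apy) //.
    exact: (subsetP (sA_ _) _ Ap'x).
  move: Ap'x Apy; rewrite def_x s1 mulg1 => Ap'y Apy.
  have: y \in 'O_p(A) :&: 'O_p^'(A) by rewrite inE Apy.
  by rewrite coprime_TIg // (@pnat_coprime p) ?[_.-nat _]pcore_pgroup.
apply/subsetP=> g Ap'g; apply/centP=> n Nn; apply/commgP.
rewrite -in_set1; suff: [~ g, n] \in 'O_p^'(A) :&: ('O_p(A) <*> S) by rewrite tiP.
apply/setIP; split.
  have Qn : n \in A <*> L by rewrite (subsetP (joing_subr _ _)) ?(subsetP sNL).
  by rewrite commgEl groupM ?groupV // memJ_norm ?(subsetP nAp').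
have Pn := subsetP sNP n Nn.
rewrite -groupV invg_comm commgEl groupM ?groupV //.
(* Writing [g = l * s] gives [n ^ g = (n ^ l) ^ s], with [n ^ l] in [N], and ['O_p(A) <*> S]
   contains both [N] and [S]. *)
have: g \in L * S by rewrite defLS -defAS (subsetP (mulG_subl _ _)) ?(subsetP (pcore_sub _ _) _ Ap'g).
case/mulsgP=> l s Ll Ss ->; rewrite conjgM groupJ //; last exact: subsetP (joing_subr _ _) s Ss.
by rewrite (subsetP sNP) // memJ_norm ?(subsetP nNL).
Qed.

Lemma minimal_normal_cent_core (gT : finGroupType) (A L S N : {group gT}) (p : nat) :
    holomorph_factorization A L S -> p.-group N -> minnormal N L -> N \subset L ->
    'C_L(N) = N -> L \subset 'C('O_p^'(A)) ->
  A \subset 'C(N).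
Proof.
move=> hALS pN minN sNL cNN cLA'.
case/mingroupP: minN => /andP[ntN nNL] minNK.
have nsNL : N <| L by apply/andP.
have [abA nAS defAS defLS [tiAS tiLS]] := hALS.
have sA_ pi : 'O_pi(A) \subset A by apply: pcore_sub.
have nS pi := factor_normS pi hALS.
have cA'N := normal_pgroup_cent_p'core hALS nsNL pN.
have sSQ : S \subset A <*> L by rewrite -defAS mulG_subr.
have cSA' : S \subset 'C('O_p^'(A)).
  rewrite (subset_trans sSQ) // join_subG cLA' andbT.
  exact: centSS (subxx _) (sA_ _) abA.
(* [A <*> L] is the product of ['O_p(A)], ['O_p^'(A)] and [S]; the second factor centralises the
   other two. *)
have nLP : L \subset 'N('O_p(A) <*> S).
  apply: subset_trans (joing_subr A L) _; rewrite -defAS mulG_subG.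
  rewrite [S \subset _](subset_trans (joing_subr _ S) (normG _)) andbT.
  rewrite -{1}(abelian_pcoreE p abA) mulG_subG.
  apply/andP; split; first exact: subset_trans (joing_subl _ S) (normG _).
  apply: cents_norm; rewrite centsC join_subG [S \subset _]cSA' andbT.
  exact: centSS (sA_ _) (sA_ _) abA.
have nsPL : L :&: ('O_p(A) <*> S) <| L by rewrite /normal subsetIl normsI ?normG.
have hallP := factor_Hall p hALS.
have sNP : N \subset L :&: ('O_p(A) <*> S).
  by rewrite subsetI sNL (normal_pgroup_sub_part hALS).
(* By minimality [N] lies in the centre of this normal [p]-subgroup, which is therefore contained in
   ['C_L(N) = N]. *)
have defN : L :&: ('O_p(A) <*> S) = N.
  apply/eqP; rewrite eqEsubset sNP andbT -cNN subsetI subsetIl /=.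
  rewrite centsC; suff <- : N :&: 'Z(L :&: ('O_p(A) <*> S)) = N.
    by rewrite subIset // subIset ?orbT // centS ?orbT.
  apply: (minNK (N :&: 'Z(_))%G); last exact: subsetIl.
  rewrite normsI ?gFnorm_trans ?normal_norm // andbT.
  have nilP := pgroup_nil (pHall_pgroup hallP).
  exact: meet_center_nil nilP (normalS sNP (subsetIl _ _) nsNL) ntN.
have oN : #|N| = #|'O_p(A)| by rewrite -defN (card_factor_part hALS) ?sA_ ?nS.
have nQA := factor_norm_pcore p hALS.
have sLQ : L \subset A <*> L := joing_subr A L.
have nAN : N \subset 'N('O_p(A)) := subset_trans sNL (subset_trans sLQ nQA).
pose F0 := 'C_('O_p(A))(N)%G.
(* In the [p]-group ['O_p(A) <*> N], the nontrivial normal subgroup ['O_p(A)] meets the centre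
   nontrivially. *)
have ntF0 : F0 :!=: 1.
  have pAN : p.-group ('O_p(A) <*> N) by rewrite norm_joinEr // pgroupM pcore_pgroup.
  have ntA : 'O_p(A) != 1 by rewrite -cardG_gt1 -oN cardG_gt1.
  have nsA : 'O_p(A) <| 'O_p(A) <*> N by rewrite normalYl.
  apply: contraNneq (meet_center_nil (pgroup_nil pAN) nsA ntA) => F0_1.
  rewrite -subG1 -F0_1 subsetI subsetIl subIset //; apply/orP; right.
  by rewrite subIset // centS ?joing_subr ?orbT.
have sF0A : F0 \subset A by rewrite subIset // sA_.
have nF0Q : A <*> L \subset 'N(F0).
  rewrite join_subG (cents_norm (centSS (subxx _) sF0A abA)).
  by rewrite normsI ?norms_cent // (subset_trans sLQ nQA).
have nF0S := subset_trans sSQ nF0Q.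
pose F := (L :&: (F0 <*> S))%G.
have oF : #|F| = #|F0| by rewrite (card_factor_part hALS).
have sFN : F \subset N.
  by rewrite -defN setIS // genS // setSU // subsetIl.
have nNF : N \subset 'N(F).
  apply/cents_norm/(centSS (subxx _) sFN).
  by rewrite -{1}cNN subsetIr.
(* If [x = a * s], then [f ^ x = f ^ s], since [a] centralises [N] and [f] lies in [N]; this stays
   in [F0 <*> S]. *)
have nA'F : L :&: ('O_p^'(A) <*> S) \subset 'N(F).
  apply/subsetP=> x /setIP[Lx]; rewrite norm_joinEr ?nS // => /mulsgP[a s A'a Ss def_x].
  rewrite inE; apply/subsetP=> _ /imsetP[f Ff ->].
  have [Lf F0f] := setIP Ff.
  rewrite inE groupJ //= def_x conjgM groupJ ?(subsetP (joing_subr _ _) s) //.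
  rewrite /conjg -(centsP cA'N a A'a f) ?mulKg // (subsetP sFN) //.
(* [N] and [L :&: ('O_p^'(A) <*> S)] are Hall subgroups of [L] for complementary sets of primes, so
   together they force the normaliser to be all of [L]. *)
have nLF : L \subset 'N(F).
  have hallP' := factor_Hall p^' hALS; rewrite defN in hallP.
  apply/setIidPl/eqP; rewrite eqEcard subsetIl dvdn_leq ?cardG_gt0 //.
  rewrite -(partnC p (cardG_gt0 L)) Gauss_dvd ?coprime_partC //.
  by rewrite -(card_Hall hallP) -(card_Hall hallP') !cardSg ?subsetI ?subsetIl ?sNL.
have defF : F :=: N.
  apply: minNK => //; rewrite nLF andbT -cardG_gt1 oF cardG_gt1 //.
have cAN : 'O_p(A) \subset 'C(N).
  suff <-: F0 :=: 'O_p(A) by apply: subsetIr.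
  have oF0 : #|'O_p(A)| = #|F0| by rewrite -oN -oF defF.
  by apply/eqP; rewrite eqEcard subsetIl oF0 /=.
by rewrite -{1}(abelian_pcoreE p abA) mul_subG.
Qed.

(** * Centralisers of transitive permutation groups *)

Lemma transitive_cent_semiregular (T : finType) (M : {group {perm T}}) (c : {perm T}) (x : T) :
  [transitive M, on [set: T] | 'P] -> c \in 'C(M) -> c x = x -> c = 1.
Proof.
move=> trM cMc cx; apply/permP=> y; rewrite perm1.
have [m Mm ->] : exists2 m, m \in M & y = m x.
  by have /orbitP[m Mm <-] : y \in orbit 'P M x; [rewrite (atransP trM) ?inE | exists m].
by rewrite -permM -(centP cMc m Mm) permM cx.
Qed.

(** If [m] in [M] agrees with [c] at [x], then [c * m^-1] centralises [M] and fixes [x], hence is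
    trivial. *)
Lemma abelian_transitive_self_cent (T : finType) (G M : {group {perm T}}) (x : T) :
    M \subset G -> abelian M -> [transitive M, on [set: T] | 'P] -> 'C_G(M) = M.
Proof.
move=> sMG abM trM; apply/eqP; rewrite eqEsubset subsetI sMG -/(abelian M) abM !andbT.
apply/subsetP=> c /setIP[_ cMc].
have /orbitP[m Mm /= mx] : c x \in orbit 'P M x by rewrite (atransP trM) ?inE.
suff /eqP : c * m^-1 = 1 by rewrite -eq_mulgV1 => /eqP->.
apply: (transitive_cent_semiregular (x := x) trM).
  by rewrite groupM ?groupV // (subsetP abM).
by rewrite permM -mx /aperm permK.
Qed.

Lemma mem_sigma (X : finCycleSet) (x : X) : sigma x \in permutation_group X.
Proof. by rewrite mem_gen ?imset_f. Qed.

(** * The holomorph attached to a cycle set *)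

Section Holomorph.

Variable X : finCycleSet.
Local Notation G := (permutation_group X).
Local Notation T := (subg_of G).

Definition translation_fun (x : X) (g : T) : T := g * subg G (sigma (sgval g x)).

Lemma translation_funE (x : X) (g : T) :
  sgval (translation_fun x g) = sgval g * sigma (sgval g x).
Proof. by rewrite sgvalM ?inE // [sgval (subg _ _)]subgK ?mem_sigma. Qed.

(* Evaluating [g * sigma (g x)] at [x] gives the square of [g x], so
   non-degeneracy recovers [g x], and then [g]. *)
Lemma translation_inj (x : X) : injective (translation_fun x).
Proof.
move=> g h /(congr1 sgval); rewrite !translation_funE => eq_gh.
have /= := congr1 (fun s : {perm X} => s x) eq_gh; rewrite !permM !sigmaE => eq_x.
move: eq_gh; rewrite (bij_inj (cs_non_degenerate X) eq_x) => /mulIg.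
exact: val_inj.
Qed.

Definition translation (x : X) : {perm T} := perm (translation_inj (x := x)).

Lemma translationE (x : X) (g : T) :
  sgval (translation x g) = sgval g * sigma (sgval g x).
Proof. by rewrite permE translation_funE. Qed.

(* The inverse makes [left_mul] a morphism for the left-to-right product. *)
Definition left_mul (k : {perm X}) : {perm T} := perm (mulgI (subg G k)^-1).

Lemma left_mulM : {in G &, {morph left_mul : k l / k * l}}.
Proof.
move=> k l Gk Gl; apply/permP=> g.
by rewrite permM !permE subgM // invMg mulgA.
Qed.
Canonical left_mul_morphism := Morphism left_mulM.

Lemma left_mulE (k : {perm X}) (g : T) :
  k \in G -> sgval (left_mul k g) = k^-1 * sgval g.
Proof. by move=> Gk; rewrite permE sgvalM ?inE // -[in RHS](subgK _ Gk). Qed.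

Lemma injm_left_mul : 'injm left_mul.
Proof.
apply/injmP=> k l Gk Gl /(congr1 (fun s : {perm T} => sgval (s 1))).
by rewrite !left_mulE // => /mulIg/invg_inj.
Qed.

(** Through this, transitivity of a subgroup of [G] on [X] becomes conjugacy of all translations
    under its image. *)
Lemma translationJ (k : {perm X}) (x : X) :
  k \in G -> translation x ^ left_mul k = translation (k x).
Proof.
move=> Gk; apply/permP=> g; rewrite -(permKV (left_mul k) g).
move: ((left_mul k)^-1 g) => h; rewrite permJ; apply: subg_inj.
by rewrite translationE !left_mulE // translationE mulgA permM permK.
Qed.

(** Evaluated at [g], this is the cycle law for the points [g x] and [g y]. *)
Lemma translationC (x y : X) : commute (translation x) (translation y).
Proof.
apply/permP=> g; apply: subg_inj; rewrite !permM !translationE -!mulgA; congr (_ * _).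
by apply/permP=> z; rewrite !permM !sigmaE cs_cycle_law.
Qed.

Definition translations : {group {perm T}} := <<[set translation x | x : X]>>%G.
Definition left_muls : {group {perm T}} := (left_mul @* G)%G.
Definition point_stab : {group {perm T}} := 'C_(translations <*> left_muls)[1 | 'P]%G.

Lemma translations_abelian : abelian translations.
Proof.
rewrite /abelian cent_gen gen_subG; apply/subsetP=> _ /imsetP[x _ ->].
by apply/centP=> _ /imsetP[y _ ->]; apply: translationC.
Qed.

Lemma translations_norm : left_muls \subset 'N(translations).
Proof.
apply/subsetP=> _ /morphimP[k Gk _ ->]; rewrite inE -genJ genS //.
apply/subsetP=> _ /imsetP[_ /imsetP[x _ ->] ->].
by rewrite translationJ // imset_f.
Qed.

(** By finiteness every element of [G] is a product of permutations [sigma y] without inverses; the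
    orbit of [1] is followed along such a word. *)
Lemma translations_transitive : [transitive translations, on [set: T] | 'P].
Proof.
apply/imsetP; exists 1; rewrite ?inE //; apply/eqP; rewrite eq_sym eqEsubset subsetT /=.
apply/subsetP=> g _; rewrite -[g]sgvalK; have := valP g.
case/gen_prodgP=> n [c sigma_c ->]; have Gc i : c i \in G by apply: mem_gen.
elim: n => [|n IHn] in c sigma_c Gc *; first by rewrite big_ord0 (morph1 _) orbit_refl.
rewrite big_ord_recr subgM ?group_prod //=.
have /imsetP[y _ ->] := sigma_c ord_max.
set k := \prod_(i < n) _; have Gk : k \in G by apply: group_prod.
have: subg G k \in orbit 'P translations 1 by apply: IHn.
(* Since [k] sends [k^-1 y] to [y], this translation appends [sigma y] to the word [k]. *)
move=> Ok; have -> : subg G k * subg G (sigma y) = translation (k^-1 y) (subg G k).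
  apply: subg_inj; rewrite translationE sgvalM ?inE //.
  by rewrite ![sgval (subg _ _)]subgK ?mem_sigma // permKV.
apply: orbit_trans Ok; apply: (mem_orbit 'P); rewrite mem_gen ?imset_f //.
Qed.

Lemma left_muls_transitive : [transitive left_muls, on [set: T] | 'P].
Proof.
apply/imsetP; exists 1; rewrite ?inE //; apply/eqP; rewrite eq_sym eqEsubset subsetT /=.
apply/subsetP=> g _; apply/orbitP; exists (left_mul (sgval g)^-1).
  by rewrite mem_morphim ?groupV ?(valP g).
by apply: subg_inj; rewrite /= /aperm left_mulE ?groupV ?(valP g) // invgK mulg1.
Qed.

(** A transitive subgroup supplements the point stabiliser. The intersections vanish because a
    nontrivial element of an abelian transitive group, or a nontrivial left multiplication, fixes no
    point. *)
Lemma holomorph_factorization_cycle_set :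
  holomorph_factorization translations left_muls point_stab.
Proof.
have sSQ : point_stab \subset translations <*> left_muls by apply: subsetIl.
have nAS : point_stab \subset 'N(translations).
  by rewrite (subset_trans sSQ) // join_subG normG translations_norm.
have stab_mul (H : {group {perm T}}) : H \subset translations <*> left_muls ->
    [transitive H, on [set: T] | 'P] -> point_stab * H = translations <*> left_muls.
  move=> sHQ trH; apply/(subgroup_transitiveP _ sHQ); rewrite ?inE //.
  rewrite (atrans_supgroup sHQ trH); apply/subsetP=> a _.
  by rewrite !inE; apply/subsetP=> x _; rewrite !inE.
split=> //; first exact: translations_abelian.
- by rewrite -(normC nAS) (stab_mul _ (joing_subl _ _) translations_transitive).
- have := stab_mul _ (joing_subr _ _) left_muls_transitive.
  by move/(congr1 (fun B => B^-1)); rewrite invMg !invGid.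
split; apply/trivgP/subsetP=> s /setIP[].
  move=> As /setIP[_ /astab1P s1]; apply/set1P.
  apply: transitive_cent_semiregular translations_transitive _ s1.
  exact: subsetP translations_abelian s As.
case/morphimP=> k _ Gk -> /setIP[_ /astab1P/(congr1 sgval)].
rewrite /= /aperm left_mulE // mulg1 => k1; apply/set1P.
by rewrite -(invgK k) k1 invg1 (morph1 _).
Qed.

Lemma sigma_constant (M : {group {perm X}}) :
    M <| G -> minnormal M G -> [transitive M, on [set: X] | 'P] ->
  abelian M /\ forall x y : X, sigma x = sigma y.
Proof.
move=> nsMG minM trM; have hALS := holomorph_factorization_cycle_set.
have [sMG nMG] := andP nsMG.
have solG : solvable G.
  by rewrite -(injm_sol injm_left_mul) //; apply: factor_solvable hALS.
have [_ ntM /is_abelemP[p p_pr abM]] := minnormal_solvable minM sMG solG.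
have cMM := abelem_abelian abM; split=> //.
pose N := (left_mul @* M)%G.
have sNL : N \subset left_muls by apply: morphimS.
have pN : p.-group N by rewrite morphim_pgroup ?(abelem_pgroup abM).
have minN : minnormal N left_muls by rewrite injm_minnormal ?injm_left_mul.
have cNN : 'C_left_muls(N) = N.
  have [x] := proj1 (cs_left_quasigroup X).
  by rewrite -injm_subcent ?injm_left_mul // (abelian_transitive_self_cent x).
have nsNL : N <| left_muls by apply: morphim_normal.
have transM x y : exists2 n, n \in N & translation x ^ n = translation y.
  have /orbitP[m Mm /= my] : y \in orbit 'P M x by rewrite (atransP trM) ?inE.
  by exists (left_mul m); rewrite ?mem_morphim ?translationJ ?(subsetP sMG) // -my.
have cAN : translations \subset 'C(N).
  apply: (minimal_normal_cent_core hALS pN minN sNL cNN).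
  have [x0] := proj1 (cs_left_quasigroup X).
  have abA := translations_abelian.
  have hallA pi := nilpotent_pcore_Hall pi (abelian_nil abA).
  have A_ x : translation x \in translations by rewrite mem_gen ?imset_f.
  have cA'N := normal_pgroup_cent_p'core hALS nsNL pN.
  have A_part pi x : (translation x).`_pi \in 'O_pi(translations).
    by rewrite (mem_Hall_pcore (hallA pi)) ?groupX ?p_elt_constt.
  pose c := (translation x0).`_p^'.
  (* [n] carries one translation to the other but centralises the [p']-part. *)
  have part_c x : (translation x).`_p^' = c.
    have [n Nn <-] := transM x0 x; rewrite consttJ.
    by rewrite /conjg (centsP cA'N _ (A_part _ x0) n Nn) mulKg.
  (* Every translation lies in ['O_p(translations) <*> <[c]>], so the modular law leaves only
     [<[c]>] for the [p']-core. *)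
  have sA'c : 'O_p^'(translations) \subset <[c]>.
    have sAc : translations \subset 'O_p(translations) <*> <[c]>.
      rewrite gen_subG; apply/subsetP=> _ /imsetP[x _ ->].
      rewrite -(consttC p (translation x)) part_c groupM //.
        by rewrite (subsetP (joing_subl _ _)).
      by rewrite (subsetP (joing_subr _ _)) ?cycle_id.
    have sc : <[c]> \subset 'O_p^'(translations) by rewrite cycle_subG A_part.
    have tiA : 'O_p^'(translations) :&: 'O_p(translations) = 1.
      by rewrite setIC coprime_TIg // (@pnat_coprime p) ?[_.-nat _]pcore_pgroup.
    have nc : <[c]> \subset 'N('O_p(translations)).
      by rewrite gFnorm_trans // cycle_subG (subsetP (normG _)) // groupX.
    rewrite -[<[c]>]mul1g -tiA group_modr // -norm_joinEr //.
    by rewrite subsetI subxx (subset_trans (pcore_sub _ _)).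
  rewrite centsC (subset_trans sA'c) // cycle_subG; apply/centP=> l Ll.
  apply/commgP/conjg_fixP.
  have /morphimP[k _ Gk ->] := Ll.
  by rewrite -consttJ translationJ // part_c.
move=> x y; have [n Nn] := transM x y.
rewrite /conjg (centsP cAN _ _ n Nn) ?mulKg ?mem_gen ?imset_f // => eq_xy.
by have := congr1 (fun s : {perm T} => sgval (s 1)) eq_xy; rewrite !translationE !mul1g !perm1.
Qed.

End Holomorph.

(** * Prime cardinality and conclusion *)

Lemma card_transitive_abelian (T : finType) (M : {group {perm T}}) :
  abelian M -> [transitive M, on [set: T] | 'P] -> #|T| = #|M|.
Proof.
move=> abM trM; have [x _ defT] := imsetP trM.
rewrite -cardsT defT card_orbit; suff -> : 'C_M[x | 'P] = 1 by rewrite indexg1.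
apply/trivgP/subsetP=> c /setIP[Mc /astab1P cx]; apply/set1P.
exact: transitive_cent_semiregular trM (subsetP abM c Mc) cx.
Qed.

Unset Implicit Arguments.

Theorem proposition26 (X : finCycleSet)
    (hindec : indecomposable X)
    (hinn : innately_transitive (permutation_group X)) :
  [/\ trivial_cycle_set X, indecomposable X
    & exists p : nat, prime p /\ #|X| = p].
Proof.
have [M [nsMG minM trM]] := hinn.
have [abM sigma_eq] := sigma_constant nsMG minM trM.
have [x0] := proj1 (cs_left_quasigroup X).
split=> //; first by exists (sigma x0) => x y; rewrite -(sigma_eq x) sigmaE.
(* A single permutation generates [G], so the elementary abelian subgroup [M] is cyclic, of order
   [p]; being regular, it has as many elements as [X]. *)
have cycG : cyclic (permutation_group X).
  apply/cyclicP; exists (sigma x0); congr <<_>>; apply/setP=> s; rewrite inE.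
  apply/imsetP/eqP=> [[x _ ->]|->]; [exact: sigma_eq | by exists x0].
have [_ ntM /is_abelemP[p p_pr abelM]] :=
  minnormal_solvable minM (normal_sub nsMG) (abelian_sol (cyclic_abelian cycG)).
exists p; split=> //; rewrite (card_transitive_abelian abM trM).
exact: cyclic_abelem_prime abelM (cyclicS (normal_sub nsMG) cycG) ntM.
Qed.
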